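(* Fix $\lambda\in[0,1)$ and $p\in[0,1]$. For every $\mathbf{v}^0\in\overline{\mathcal{V}}^\infty$, letting $\mathbf{v}(\mathbf{v}^0,t)$ be the unique solution to the fluid model with initial condition $\mathbf{v}^0$, we have $\lim_{t\to\infty}\|\mathbf{v}(\mathbf{v}^0,t)-\mathbf{v}^I\|_w=0$, where $\mathbf{v}^I$ is the unique element of $\overline{\mathcal{V}}^\infty$ satisfying $\lambda(\mathbf{v}^I_{i-1}-\mathbf{v}^I_i)-(1-p)(\mathbf{v}^I_i-\mathbf{v}^I_{i+1})-g_i(\mathbf{v}^I)=0$ for all $i\ge1$.
   Context: $\mathbb{Z}_+=\{0,1,2,\dots\}$. $\mathcal{S}=\{\mathbf{s}\in[0,1]^{\mathbb{Z}_+}:1=\mathbf{s}_0\ge\mathbf{s}_1\ge\cdots\ge0\}$, $\overline{\mathcal{S}}^\infty=\{\mathbf{s}\in\mathcal{S}:\sum_{i\ge1}\mathbf{s}_i<\infty\}$, $\overline{\mathcal{V}}^\infty=\{\mathbf{v}:\mathbf{v}_i=\sum_{j\ge i}\mathbf{s}_j\ \forall i,\ \text{for some }\mathbf{s}\in\overline{\mathcal{S}}^\infty\}$. Weighted norm: $\|\mathbf{x}\|_w^2=\sum_{i\ge0}2^{-i}\mathbf{x}_i^2$. For $\mathbf{v}\in\overline{\mathcal{V}}^\infty$, $i\ge1$: $g_i(\mathbf{v})=p$ if $\mathbf{v}_i>0$, $=\min\{\lambda\mathbf{v}_{i-1},p\}$ if $\mathbf{v}_i=0<\mathbf{v}_{i-1}$,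 $=0$ if $\mathbf{v}_i=\mathbf{v}_{i-1}=0$. A solution to the fluid model with initial condition $\mathbf{v}^0$ is $\mathbf{v}:[0,\infty)\to\overline{\mathcal{V}}^\infty$ such that: (0) all coordinates are $L$-Lipschitz for a common constant $L$; (1) $\mathbf{v}(0)=\mathbf{v}^0$; (2) for all $t$, $\mathbf{v}_0(t)-\mathbf{v}_1(t)=1$ and $1\ge\mathbf{v}_i-\mathbf{v}_{i+1}\ge\mathbf{v}_{i+1}-\mathbf{v}_{i+2}\ge0$ for all $i\ge0$; (3) for a.e. $t$, for all $i\ge1$, $\dot{\mathbf{v}}_i=\lambda(\mathbf{v}_{i-1}-\mathbf{v}_i)-(1-p)(\mathbf{v}_i-\mathbf{v}_{i+1})-g_i(\mathbf{v})$. Such a solution exists and is unique for each $\mathbf{v}^0\in\overline{\mathcal{V}}^\infty$, and $\mathbf{v}^I$ exists and is unique. *)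

(* Defs.v *)
From Stdlib Require Import Reals Lra.
From Coquelicot Require Import Coquelicot.
Open Scope R_scope.

Definition in_S (s : nat -> R) : Prop :=
  s 0%nat = 1 /\
  (forall i, 0 <= s i <= 1) /\
  (forall i, s (S i) <= s i).

Definition in_Sbar (s : nat -> R) : Prop :=
  in_S s /\ ex_series (fun k => s (S k)).

Definition in_Vbar (v : nat -> R) : Prop :=
  exists s, in_Sbar s /\ forall i, v i = Series (fun k => s (i + k)%nat).

Definition norm_w (x : nat -> R) : R :=
  sqrt (Series (fun i => (/ 2) ^ i * (x i) ^ 2)).

Definition g (lam p : R) (v : nat -> R) (i : nat) : R :=
  if Rlt_dec 0 (v i) then p
  else if Rlt_dec 0 (v (pred i)) then Rmin (lam * v (pred i)) p
  else 0.

Definition drift (lam p : R) (v : nat -> R) (i : nat) : R :=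
  lam * (v (pred i) - v i) - (1 - p) * (v i - v (S i)) - g lam p v i.

Definition null_set (N : R -> Prop) : Prop :=
  forall eps, 0 < eps ->
    exists a b : nat -> R,
      (forall n, a n <= b n) /\
      (forall t, N t -> exists n, a n < t < b n) /\
      (forall n, sum_f_R0 (fun k => b k - a k) n <= eps).

Definition fluid_solution (lam p : R) (v0 : nat -> R) (v : nat -> R -> R) : Prop :=
  (exists L, forall i t s, 0 <= t -> 0 <= s ->
       Rabs (v i t - v i s) <= L * Rabs (t - s)) /\
  (forall t, 0 <= t -> in_Vbar (fun i => v i t)) /\
  (forall i, v i 0 = v0 i) /\
  (forall t, 0 <= t ->
     v 0%nat t - v 1%nat t = 1 /\
     forall i, 1 >= v i t - v (S i) t /\
               v i t - v (S i) t >= v (S i) t - v (S (S i)) t /\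
               v (S i) t - v (S (S i)) t >= 0) /\
  (exists N, null_set N /\
     forall t, 0 < t -> ~ N t ->
       forall i, (1 <= i)%nat ->
         is_derive (fun u => v i u) t (drift lam p (fun j => v j t) i)).

Definition is_vI (lam p : R) (vI : nat -> R) : Prop :=
  in_Vbar vI /\ forall i, (1 <= i)%nat -> drift lam p vI i = 0.

(* Main.v *)
Require Import Defs.
From Stdlib Require Import Reals Lra Lia Classical.
From Coquelicot Require Import Coquelicot.
Open Scope R_scope.

(** The drift of [v i] is nondecreasing in the neighbouring coordinates and [- g] is
    nonincreasing in [v i], so the dynamics is monotone.  Let [a i] and [b i] be the
    limsup and liminf of [v i t].  Near its limsup [v i] cannot keep a drift below a
    negative constant, so [a] satisfies the stationary equations as
    inequalities in one direction, and likewise [b] in the other; a discrete comparison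
    argument gives [a <= vI <= b].  The mass at infinity is controlled, uniformly in
    time, by a strict stationary supersolution lying above the initial condition: with
    slopes 1 up to a large index and geometric slopes of ratio in [(lam, 1)] beyond.
    This tightness also makes the coordinatewise convergence uniform in [i]. *)

(** * Null sets, and increments of Lipschitz functions from almost-everywhere derivative bounds *)

Definition lipschitz_nonneg (L : R) (f : R -> R) : Prop :=
  forall t s, 0 <= t -> 0 <= s -> Rabs (f t - f s) <= L * Rabs (t - s).

(** For [a <= b], the length of the part of the interval from [a] to [b] that lies left of [t]. *)
Definition clip (a b t : R) : R := Rmin b (Rmax a t) - a.

Lemma clip_bounds (a b t : R) : a <= b -> 0 <= clip a b t <= b - a.
Proof.
  intros H; unfold clip, Rmin, Rmax.
  repeat destruct (Rle_dec _ _); lra.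
Qed.

Lemma clip_incr (a b s t : R) : s <= t -> clip a b s <= clip a b t.
Proof.
  intros H; unfold clip, Rmin, Rmax.
  repeat destruct (Rle_dec _ _); lra.
Qed.

Lemma clip_inside (a b t : R) : a <= t <= b -> clip a b t = t - a.
Proof.
  intros H; unfold clip, Rmin, Rmax.
  repeat destruct (Rle_dec _ _); lra.
Qed.

Lemma Series_le_bound (u : nat -> R) (M : R) :
  (forall n, 0 <= u n) -> (forall n, sum_f_R0 u n <= M) ->
  ex_series u /\ Series u <= M.
Proof.
  intros Hu HM.
  assert (Hs : forall n, sum_n u n = sum_f_R0 u n) by (intros; apply sum_n_Reals).
  assert (Hex : ex_finite_lim_seq (sum_n u)).
  { apply (ex_finite_lim_seq_incr (sum_n u) M).
    - intros n; rewrite sum_Sn; unfold plus; simpl; specialize (Hu (S n)); lra.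
    - intros n; rewrite Hs; apply HM. }
  destruct Hex as [l Hl].
  split; [exists l; exact Hl|].
  rewrite (is_series_unique u l Hl).
  assert (H := is_lim_seq_le (sum_n u) (fun _ => M) l M).
  apply H; [intros n; rewrite Hs; apply HM | exact Hl | apply is_lim_seq_const].
Qed.

Lemma term_le_Series (u : nat -> R) (n : nat) :
  (forall k, 0 <= u k) -> ex_series u -> u n <= Series u.
Proof.
  intros Hu Hex.
  rewrite (Series_incr_n u (S n)); [|lia|exact Hex].
  assert (H1 : 0 <= Series (fun k => u (S n + k)%nat)).
  { rewrite <- (Rmult_0_l (Series (fun k => u (S n + k)%nat))).
    rewrite <- Series_scal_l. apply Series_le.
    - intros k; specialize (Hu (S n + k)%nat); lra.
    - apply (ex_series_incr_n u (S n)); exact Hex. }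
  simpl pred.
  assert (H2 : u n <= sum_f_R0 u n).
  { destruct n; simpl; [lra|].
    assert (0 <= sum_f_R0 u n) by (apply cond_pos_sum; intros; apply Hu). lra. }
  lra.
Qed.

(* [m] is the length of the part of a cover of [N] to the left of [t]; its growth
   pays for the points where [f] has no controlled derivative. *)
Lemma null_set_charge (N : R -> Prop) (eps : R) :
  null_set N -> 0 < eps ->
  exists m : R -> R,
    (forall t, 0 <= m t <= eps) /\
    (forall s t, s <= t -> m s <= m t) /\
    (forall t, N t -> exists d, 0 < d /\
       forall s, t <= s <= t + d -> s - t <= m s - m t).
Proof.
  intros HN He.
  destruct (HN eps He) as (a & b & Hab & Hcov & Hsum).
  assert (Hpart : forall t n, sum_f_R0 (fun k => clip (a k) (b k) t) n <= eps).
  { intros t n; apply Rle_trans with (2 := Hsum n).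
    apply sum_Rle; intros k _; apply clip_bounds, Hab. }
  assert (Hpos : forall t k, 0 <= clip (a k) (b k) t)
    by (intros; apply clip_bounds, Hab).
  assert (Hex : forall t, ex_series (fun k => clip (a k) (b k) t))
    by (intros t; apply (Series_le_bound _ eps (Hpos t) (Hpart t))).
  exists (fun t => Series (fun k => clip (a k) (b k) t)).
  split; [|split].
  - intros t; split; [|apply (Series_le_bound _ eps (Hpos t) (Hpart t))].
    apply Rle_trans with (1 := Hpos t 0%nat).
    exact (term_le_Series (fun k => clip (a k) (b k) t) 0 (Hpos t) (Hex t)).
  - intros s t Hst; apply Series_le; [|apply Hex].
    intros k; split; [apply Hpos | apply clip_incr, Hst].
  - intros t Ht; destruct (Hcov t Ht) as [n Hn].
    (* The one interval that covers [t] already contributes [s - t]; every other term is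
       nondecreasing. *)
    exists (b n - t); split; [lra|]; intros s Hs.
    rewrite <- Series_minus by apply Hex.
    assert (H := term_le_Series
      (fun k => clip (a k) (b k) s - clip (a k) (b k) t) n).
    cbv beta in H; rewrite (clip_inside _ _ s), (clip_inside _ _ t) in H by lra.
    apply Rle_trans with (s - a n - (t - a n)); [lra|]; apply H.
    + intros k; assert (H' := clip_incr (a k) (b k) t s); lra.
    + apply (ex_series_minus (V := R_NormedModule)); apply Hex.
Qed.

Lemma is_derive_right_bound (f : R -> R) (t l c : R) :
  is_derive f t l -> l < c ->
  exists d, 0 < d /\ forall s, t <= s <= t + d -> f s - f t <= c * (s - t).
Proof.
  intros Hd Hl; apply is_derive_Reals in Hd.
  destruct (Hd (c - l)) as [d Hd']; [lra|].
  assert (Hdp := cond_pos d).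
  exists (d / 2); split; [lra|]; intros s Hs.
  destruct (Req_dec s t) as [->|Hne]; [lra|].
  specialize (Hd' (s - t)).
  replace (t + (s - t)) with s in Hd' by ring.
  assert (H : Rabs ((f s - f t) / (s - t) - l) < c - l).
  { apply Hd'; [lra|]; rewrite Rabs_right; lra. }
  apply Rabs_def2 in H; destruct H as [H _].
  assert (H2 : (f s - f t) / (s - t) < c) by lra.
  apply Rmult_lt_compat_r with (r := s - t) in H2; [|lra].
  unfold Rdiv in H2; rewrite Rmult_assoc, Rinv_l in H2; lra.
Qed.

(** Continuous induction on the points up to which the bound holds with slope [c + eta] and the
    extra charge [M * (m x - m a)]. The supremum of these points is again such a point and can be
    pushed to the right: off [N] by the derivative, on [N] because [m] grows at rate at least 1
    there. Then [eta] tends to 0. *)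
Lemma ae_derive_le_increment (f : R -> R) (N : R -> Prop) (K c a b : R) :
  null_set N -> a <= b ->
  (forall t s, a <= t <= b -> a <= s <= b -> Rabs (f t - f s) <= K * Rabs (t - s)) ->
  (forall t, a <= t < b -> ~ N t -> exists l, is_derive f t l /\ l <= c) ->
  f b - f a <= c * (b - a).
Proof.
  intros HN Hab HL HD.
  (* [M] is at least [K - c], the excess of the Lipschitz slope over [c] at an exceptional point. *)
  set (M := Rabs K + Rabs c).
  assert (HM : 0 <= M) by (unfold M; generalize (Rabs_pos K) (Rabs_pos c); lra).
  assert (Main : forall eta, 0 < eta -> f b - f a <= (c + eta) * (b - a) + M * eta).
  { intros eta Heta.
    destruct (null_set_charge N eta HN Heta) as (m & Hm & Hmi & HmN).
    set (E := fun x => a <= x <= b /\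
                f x - f a <= (c + eta) * (x - a) + M * (m x - m a)).
    assert (Ea : E a) by (unfold E; split; [lra|]; lra).
    destruct (completeness E) as [x [Hub Hlub]].
    { exists b; intros x [Hx _]; lra. }
    { exists a; exact Ea. }
    assert (Hax : a <= x) by (apply Hub, Ea).
    assert (Hxb : x <= b) by (apply Hlub; intros y [Hy _]; lra).
    assert (Ex : E x).
    { split; [lra|]; apply le_epsilon; intros e He.
      (* [C] exceeds a Lipschitz constant of [f x - (c + eta) * x]; the charge is handled by
         monotonicity of [m] alone. *)
      set (C := Rabs K + Rabs (c + eta) + 1).
      assert (HC : 0 < C)
        by (unfold C; generalize (Rabs_pos K) (Rabs_pos (c + eta)); lra).
      assert (HeC : 0 < e / C) by (apply Rdiv_lt_0_compat; lra).
      assert (Hy : exists y, E y /\ x - e / C < y).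
      { apply NNPP; intros Hn.
        assert (x <= x - e / C); [|lra].
        apply Hlub; intros y Hy; apply Rnot_lt_le; intros Hlt.
        apply Hn; exists y; split; assumption. }
      destruct Hy as (y & [Hyab Hy] & Hyx).
      assert (Hyx' : y <= x) by (apply Hub; split; assumption).
      assert (H1 := HL x y ltac:(lra) ltac:(lra)).
      assert (H2 := Rle_abs (f x - f y)).
      rewrite (Rabs_right (x - y)) in H1 by lra.
      assert (H3 := Rle_abs K).
      assert (H4 := Rle_abs (- (c + eta))); rewrite Rabs_Ropp in H4.
      assert (H5 := Hmi y x Hyx').
      assert (H6 : C * (x - y) <= e).
      { apply Rle_trans with (C * (e / C)); [apply Rmult_le_compat_l; lra|].
        right; field; lra. }
      assert (H7 : K * (x - y) <= Rabs K * (x - y)) by (apply Rmult_le_compat_r; lra).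
      assert (H8 : - (c + eta) * (x - y) <= Rabs (c + eta) * (x - y))
        by (apply Rmult_le_compat_r; lra).
      assert (H9 : M * (m y - m a) <= M * (m x - m a))
        by (apply Rmult_le_compat_l; lra).
      unfold C in H6; nra. }
    destruct (Req_dec x b) as [->|Hne].
    { destruct Ex as [_ Ex].
      assert (M * (m b - m a) <= M * eta); [|lra].
      apply Rmult_le_compat_l; [lra|]; generalize (Hm a) (Hm b); lra. }
    exfalso.
    assert (Hd : exists d, 0 < d /\ forall s, x <= s <= x + d -> s <= b ->
              f s - f x <= (c + eta) * (s - x) + M * (m s - m x)).
    { destruct (classic (N x)) as [HNx|HNx].
      - destruct (HmN x HNx) as (d & Hd & Hs).
        exists d; split; [exact Hd|]; intros s Hxs Hsb.
        specialize (Hs s Hxs).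
        assert (H1 := HL s x ltac:(lra) ltac:(lra)).
        assert (H2 := Rle_abs (f s - f x)).
        rewrite (Rabs_right (s - x)) in H1 by lra.
        assert (H3 := Rle_abs K).
        assert (H4 := Rle_abs (- c)); rewrite Rabs_Ropp in H4.
        assert (H5 : M * (s - x) <= M * (m s - m x))
          by (apply Rmult_le_compat_l; lra).
        assert (H6 : (K - c) * (s - x) <= M * (s - x))
          by (apply Rmult_le_compat_r; [lra|unfold M; lra]).
        assert (0 <= eta * (s - x)) by (apply Rmult_le_pos; lra).
        lra.
      - destruct (HD x ltac:(lra) HNx) as (l & Hl & Hlc).
        destruct (is_derive_right_bound f x l (c + eta) Hl ltac:(lra)) as (d & Hd & Hs).
        exists d; split; [exact Hd|]; intros s Hxs _.
        specialize (Hs s Hxs).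
        assert (0 <= M * (m s - m x)).
        { apply Rmult_le_pos; [lra|]; assert (H := Hmi x s); lra. }
        lra. }
    destruct Hd as (d & Hd & Hs).
    set (s := Rmin (x + d) b).
    assert (Hsx : x < s) by (apply Rmin_glb_lt; lra).
    assert (Hs1 : s <= x + d) by apply Rmin_l.
    assert (Hs2 : s <= b) by apply Rmin_r.
    specialize (Hs s ltac:(lra) Hs2).
    destruct Ex as [_ Ex].
    assert (s <= x); [|lra].
    apply Hub; split; lra. }
  apply le_epsilon; intros e He.
  assert (Hden : 0 < b - a + M + 1) by lra.
  specialize (Main (e / (b - a + M + 1)) ltac:(apply Rdiv_lt_0_compat; lra)).
  set (q := e / (b - a + M + 1)) in *.
  assert (Hq : q * (b - a + M + 1) = e) by (unfold q; field; lra).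
  assert (0 < q) by (apply Rdiv_lt_0_compat; lra).
  nra.
Qed.

(* Following [f] backwards: a high value together with a uniformly negative slope
   at high values forces an even higher value [tau] earlier. *)
Lemma higher_earlier (L rho c : R) :
  0 <= L -> 0 < rho -> 0 < c ->
  exists tau kappa, 0 < tau /\ 0 < kappa /\ kappa <= rho / 2 /\ L * tau <= rho / 2 /\
    forall (f : R -> R) (N : R -> Prop) (a t : R),
      null_set N -> lipschitz_nonneg L f -> tau < t ->
      (forall s, t - tau <= s <= t -> ~ N s -> a - rho < f s ->
         exists l, is_derive f s l /\ l <= - c) ->
      a - kappa < f t -> a + kappa < f (t - tau).
Proof.
  intros HL Hrho Hc.
  (* [L + 1] keeps the quotient defined when [L = 0]. As [f] moves by at most [rho / 2] in time
     [tau] and [kappa <= rho / 2], it stays above [a - rho]; the descent [c * tau] is at least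
     [2 * kappa]. *)
  set (tau := rho / (2 * (L + 1))).
  assert (Htau : 0 < tau) by (apply Rdiv_lt_0_compat; lra).
  assert (HLt : (L + 1) * tau = rho / 2) by (unfold tau; field; lra).
  exists tau, (Rmin (rho / 2) (c * tau / 2)).
  assert (Hct : 0 < c * tau) by (apply Rmult_lt_0_compat; lra).
  assert (Hk1 := Rmin_l (rho / 2) (c * tau / 2)).
  assert (Hk2 := Rmin_r (rho / 2) (c * tau / 2)).
  split; [exact Htau|]; split; [apply Rmin_glb_lt; lra|].
  split; [exact Hk1|]; split; [lra|].
  intros f N a t HN Hf Ht HD Hft.
  assert (H : f t - f (t - tau) <= - c * (t - (t - tau))).
  { apply (ae_derive_le_increment f N L); [exact HN | lra | |].
    - intros x y Hx Hy; apply Hf; lra.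
    - intros s Hs HNs; apply HD; [lra | exact HNs |].
      assert (H := Hf t s ltac:(lra) ltac:(lra)).
      rewrite (Rabs_right (t - s)) in H by lra.
      assert (H' := Rle_abs (f t - f s)).
      assert (L * (t - s) <= L * tau) by (apply Rmult_le_compat_l; lra).
      lra. }
  lra.
Qed.

(** * Limits superior at infinity *)

Definition is_limsup (f : R -> R) (a : R) : Prop :=
  (forall eps, 0 < eps -> exists T, forall t, T <= t -> f t < a + eps) /\
  (forall eps T, 0 < eps -> exists t, T <= t /\ a - eps < f t).

(** The supremum of the levels exceeded at arbitrarily late times. [real] sends infinite values to
    0, a case excluded for bounded [f]. *)
Definition limsup_infty (f : R -> R) : R :=
  real (Lub_Rbar (fun x => forall T, exists t, T <= t /\ x < f t)).

Lemma limsup_infty_correct (f : R -> R) (A B : R) :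
  (forall t, 0 <= t -> A <= f t <= B) -> is_limsup f (limsup_infty f).
Proof.
  intros Hf; unfold limsup_infty.
  set (E := fun x => forall T, exists t, T <= t /\ x < f t).
  destruct (Lub_Rbar_correct E) as [Hub Hlub].
  assert (EA : E (A - 1)).
  { intros T; exists (Rmax T 0); split; [apply Rmax_l|].
    generalize (Hf (Rmax T 0) (Rmax_r T 0)); lra. }
  assert (EB : forall x, E x -> x <= B).
  { intros x Ex; destruct (Ex 0) as (t & Ht & Hx); generalize (Hf t Ht); lra. }
  assert (HA := Hub _ EA).
  assert (HB := Hlub (Finite B) (fun x Ex => EB x Ex)).
  destruct (Lub_Rbar E) as [a| |]; simpl in HA, HB; try contradiction.
  simpl; split.
  - intros eps He.
    assert (HnE : ~ E (a + eps / 2)).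
    { intros HE; assert (H := Hub _ HE); simpl in H; lra. }
    apply not_all_ex_not in HnE; destruct HnE as [T HT].
    exists T; intros t Ht; apply Rnot_le_lt; intros Hle.
    apply HT; exists t; split; lra.
  - intros eps T He.
    assert (Hx : exists x, E x /\ a - eps < x).
    { apply NNPP; intros Hn.
      assert (H : Rbar_le a (a - eps)); [|simpl in H; lra].
      apply Hlub; intros x Ex; simpl; apply Rnot_lt_le; intros Hlt.
      apply Hn; exists x; split; assumption. }
    destruct Hx as (x & Ex & Hx).
    destruct (Ex T) as (t & Ht & Hxt); exists t; split; lra.
Qed.

Lemma is_limsup_const (c : R) : is_limsup (fun _ => c) c.
Proof.
  split; [intros eps He; exists 0; intros; lra|].
  intros eps T He; exists T; split; lra.
Qed.

Lemma is_limsup_le (f h : R -> R) (a b c : R) :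
  is_limsup f a -> is_limsup h b ->
  (forall t, 0 <= t -> f t <= h t + c) -> a <= b + c.
Proof.
  intros [_ Hf] [Hh _] Hle; apply le_epsilon; intros e He.
  destruct (Hh (e / 2) ltac:(lra)) as [T HT].
  destruct (Hf (e / 2) (Rmax T 0) ltac:(lra)) as (t & Ht & Hft).
  assert (T <= t) by (apply Rle_trans with (2 := Ht), Rmax_l).
  assert (0 <= t) by (apply Rle_trans with (2 := Ht), Rmax_r).
  specialize (HT t ltac:(lra)); specialize (Hle t ltac:(lra)); lra.
Qed.

(** Otherwise a late time with value above [a - kappa] would force, [tau] earlier but still late, a
    value above [a + kappa], against the limsup. *)
Lemma fluctuation (L : R) (f : R -> R) (N : R -> Prop) (a rho c T : R) :
  0 <= L -> null_set N -> lipschitz_nonneg L f -> is_limsup f a ->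
  0 < rho -> 0 < c ->
  ~ (forall s, T <= s -> 0 < s -> ~ N s -> a - rho < f s ->
       exists l, is_derive f s l /\ l <= - c).
Proof.
  intros HL HN Hf [Ha1 Ha2] Hrho Hc HD.
  destruct (higher_earlier L rho c HL Hrho Hc)
    as (tau & kappa & Htau & Hk & _ & _ & Hpush).
  destruct (Ha1 kappa Hk) as [T' HT'].
  destruct (Ha2 kappa (Rmax (Rmax T T') 0 + 2 * tau) Hk) as (t & Ht & Hft).
  assert (H0 := Rmax_r (Rmax T T') 0).
  assert (H1 := Rmax_l (Rmax T T') 0).
  assert (H2 := Rmax_l T T'); assert (H3 := Rmax_r T T').
  assert (H4 : a + kappa < f (t - tau)).
  { apply (Hpush f N a t HN Hf); [lra | | exact Hft].
    intros s Hs; apply HD; lra. }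
  specialize (HT' (t - tau) ltac:(lra)); lra.
Qed.

(** * Profiles and the comparison of stationary sequences *)

Lemma pow_lt_1_eventually (q eps : R) :
  0 <= q < 1 -> 0 < eps -> exists n, q ^ n < eps.
Proof.
  intros Hq He.
  destruct (pow_lt_1_zero q ltac:(rewrite Rabs_right; lra) eps He) as [n Hn].
  exists n; specialize (Hn n (le_n n)); apply Rabs_def2 in Hn; lra.
Qed.

Lemma decr_le (x : nat -> R) (i j : nat) :
  (forall k, x (S k) <= x k) -> (i <= j)%nat -> x j <= x i.
Proof.
  intros Hx Hij; induction Hij as [|j _ IH]; [lra|]; specialize (Hx j); lra.
Qed.

(** Properties of elements of [in_Vbar] in a form that passes to coordinatewise limits superior.
    With monotonicity, the last clause says that [x] vanishes at infinity. *)
Definition profile (x : nat -> R) : Prop :=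
  x 0%nat - x 1%nat = 1 /\
  (forall i, 0 <= x i) /\
  (forall i, 0 <= x i - x (S i) <= 1) /\
  (forall eps, 0 < eps -> exists m, x m <= eps).

Lemma profile_decr (x : nat -> R) (i j : nat) :
  profile x -> (i <= j)%nat -> x j <= x i.
Proof.
  intros (_ & _ & H & _); apply decr_le; intros k; specialize (H k); lra.
Qed.

(** The differences of [x] recover [s], so the partial sums of [s] telescope to [x 0 - x (S n)];
    they converge to [Series s], which is [x 0]. *)
Lemma in_Vbar_profile (x : nat -> R) : in_Vbar x -> profile x.
Proof.
  intros (s & ((Hs0 & Hs01 & _) & Hex) & Hx).
  assert (Hex0 : ex_series s) by (apply (ex_series_incr_1 s); exact Hex).
  assert (Hexi : forall i, ex_series (fun k => s (i + k)%nat))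
    by (intros i; apply (ex_series_incr_n s i); exact Hex0).
  assert (Hstep : forall i, x i - x (S i) = s i).
  { intros i; rewrite !Hx, (Series_incr_1 (fun k => s (i + k)%nat)) by apply Hexi.
    rewrite Nat.add_0_r.
    rewrite (Series_ext (fun k => s (S i + k)%nat) (fun k => s (i + S k)%nat));
      [lra|]; intros k; f_equal; lia. }
  split; [rewrite Hstep; exact Hs0|].
  split.
  { intros i; rewrite Hx; apply Rle_trans with (s (i + 0)%nat); [apply Hs01|].
    apply (term_le_Series (fun k => s (i + k)%nat)); [|apply Hexi].
    intros k; apply Hs01. }
  split; [intros i; rewrite Hstep; apply Hs01|].
  intros eps He.
  assert (Hsum : forall n, sum_f_R0 s n = x 0%nat - x (S n)).
  { induction n as [|n IH]; simpl; [|rewrite IH]; rewrite <- Hstep; lra. }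
  destruct (Series_correct s Hex0 (ball (Series s) (mkposreal eps He))) as [n Hn].
  { exists (mkposreal eps He); intros y Hy; exact Hy. }
  specialize (Hn n (le_n n)).
  rewrite sum_n_Reals, Hsum in Hn.
  replace (Series s) with (x 0%nat) in Hn by (rewrite Hx; apply Series_ext; intros; f_equal).
  apply Rabs_def2 in Hn; unfold minus, plus, opp in Hn; simpl in Hn.
  exists (S n); lra.
Qed.

(** Nonnegative drift at index [S i], asked only where the coordinate is positive, so that [g]
    equals [p]. *)
Definition sub_stationary (lam p : R) (x : nat -> R) : Prop :=
  forall i, 0 < x (S i) ->
    (1 - p) * (x (S i) - x (S (S i))) + p <= lam * (x i - x (S i)).

(** A consequence of nonpositive drift, through [g <= p]; the discontinuity of [g] thus
    disappears. *)
Definition super_stationary (lam p : R) (y : nat -> R) : Prop :=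
  forall i, lam * (y i - y (S i)) <= (1 - p) * (y (S i) - y (S (S i))) + p.

(* Once [x - y] is positive and fails to decrease, it never decreases again, which
   is impossible since [x] vanishes at infinity; going back to index 0 then
   contradicts [x 0 - x 1 = y 0 - y 1]. *)
Lemma stationary_comparison (lam p : R) (x y : nat -> R) :
  0 <= lam < 1 -> 0 <= p <= 1 ->
  profile x -> y 0%nat - y 1%nat = 1 -> (forall i, 0 <= y i) ->
  sub_stationary lam p x -> super_stationary lam p y ->
  forall i, x i <= y i.
Proof.
  intros Hlam Hp Px Hy0 Hy Hx Hsy.
  assert (Hpx := Px); destruct Hpx as (Hx0 & Hxp & Hx1 & Hxe).
  assert (HS : forall i, x (S i) <= y (S i)).
  (* For [p = 1] a positive [x (S i)] would give [1 <= lam * (x i - x (S i)) <= lam]. *)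
  { destruct (Req_dec p 1) as [->|Hp1].
    { intros i; destruct (Rle_lt_dec (x (S i)) 0) as [H|H]; [specialize (Hy (S i)); lra|].
      specialize (Hx i H); specialize (Hx1 i); nra. }
    assert (Hup : forall i, y (S i) < x (S i) -> x i - y i <= x (S i) - y (S i) -> False).
    { intros i Hpos Hinc.
      assert (Hk : forall k, x (S i) - y (S i) <= x (S i + k)%nat - y (S i + k)%nat /\
                     x (i + k)%nat - y (i + k)%nat <= x (S i + k)%nat - y (S i + k)%nat).
      { induction k as [|k [IH1 IH2]]; [rewrite !Nat.add_0_r; lra|].
        rewrite !Nat.add_succ_r; simpl in *.
        assert (H1 := Hx (i + k)%nat); assert (H2 := Hsy (i + k)%nat).
        assert (H3 := Hy (S (i + k))).
        specialize (H1 ltac:(lra)).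
        assert (x (S (i + k)) - y (S (i + k)) <= x (S (S (i + k))) - y (S (S (i + k)))); [|lra].
        (* With [d = x - y] and [j = S (i + k)], subtracting the two inequalities gives [(1 - p) *
           (d j - d (S j)) <= lam * (d (i + k) - d j) <= 0]. *)
        apply Rmult_le_reg_l with (1 - p); [lra|]; nra. }
      destruct (Hxe ((x (S i) - y (S i)) / 2) ltac:(lra)) as [m Hm].
      destruct (Hk m) as [H _].
      assert (H1 := profile_decr x m (S i + m) Px ltac:(lia)).
      specialize (Hy (S i + m)%nat); lra. }
    induction i as [|i IH]; apply Rnot_lt_le; intros Hlt;
      eapply Hup; try exact Hlt; lra. }
  intros [|i]; [specialize (HS 0%nat); lra | apply HS].
Qed.

Lemma g_pos (lam p : R) (v : nat -> R) (i : nat) : 0 < v i -> g lam p v i = p.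
Proof. intros H; unfold g; destruct (Rlt_dec 0 (v i)); [reflexivity | lra]. Qed.

Lemma g_le (lam p : R) (v : nat -> R) (i : nat) : 0 <= p -> g lam p v i <= p.
Proof.
  intros Hp; unfold g; destruct (Rlt_dec _ _); [lra|].
  destruct (Rlt_dec _ _); [apply Rmin_r | exact Hp].
Qed.

(** * Control of the tail of a fluid solution, uniformly in time *)

Section Fluid.

Variables (lam p L : R) (v : nat -> R -> R) (N : R -> Prop).
Hypothesis Hlam : 0 <= lam < 1.
Hypothesis Hp : 0 <= p <= 1.
Hypothesis HL : 0 <= L.
Hypothesis Hlip : forall i, lipschitz_nonneg L (v i).
Hypothesis Hprof : forall t, 0 <= t -> profile (fun i => v i t).
Hypothesis HN : null_set N.
Hypothesis Hder : forall t, 0 < t -> ~ N t -> forall i, (1 <= i)%nat ->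
  is_derive (v i) t (drift lam p (fun j => v j t) i).

Lemma lip_increment (i : nat) (s t : R) :
  0 <= s <= t -> v i t <= v i s + L * (t - s).
Proof.
  intros Hst; assert (H := Hlip i t s ltac:(lra) ltac:(lra)).
  rewrite (Rabs_right (t - s)) in H by lra.
  generalize (Rle_abs (v i t - v i s)); lra.
Qed.

(** On a time grid of mesh [tau] a coordinate moves by at most [eps / 2] between grid points; at
    each grid time some index has value at most [eps / 2], and the maximum of finitely many indices
    works. *)
Lemma tail_small_bounded_time (eps T : R) :
  0 < eps -> exists m, forall t, 0 <= t <= T -> v m t <= eps.
Proof.
  intros He.
  set (tau := eps / (2 * (L + 1))).
  assert (Htau : 0 < tau) by (apply Rdiv_lt_0_compat; lra).
  assert (HLt : (L + 1) * tau = eps / 2) by (unfold tau; field; lra).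
  assert (Hk : forall k, exists m, forall t, 0 <= t <= INR k * tau -> v m t <= eps).
  { induction k as [|k [m Hm]].
    - destruct (Hprof 0 ltac:(lra)) as (_ & _ & _ & H).
      destruct (H eps He) as [m Hm].
      exists m; intros t Ht; simpl in Ht; replace t with 0 by lra; exact Hm.
    - assert (Hkt : 0 <= INR k * tau) by (apply Rmult_le_pos; [apply pos_INR|lra]).
      destruct (Hprof _ Hkt) as (_ & _ & _ & H).
      destruct (H (eps / 2) ltac:(lra)) as [m' Hm'].
      exists (max m m'); intros t Ht; rewrite S_INR in Ht.
      assert (Pt := Hprof t ltac:(lra)).
      destruct (Rle_lt_dec t (INR k * tau)) as [Hle|Hlt].
      + apply Rle_trans with (v m t); [|apply Hm; lra].
        exact (profile_decr _ m (max m m') Pt ltac:(lia)).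
      + apply Rle_trans with (v m' t);
          [exact (profile_decr _ m' (max m m') Pt ltac:(lia))|].
        assert (H1 := lip_increment m' (INR k * tau) t ltac:(lra)).
        assert (L * (t - INR k * tau) <= L * tau) by (apply Rmult_le_compat_l; lra).
        lra. }
  destruct (INR_unbounded (T / tau)) as [k HkT].
  destruct (Hk k) as [m Hm]; exists m; intros t Ht; apply Hm.
  split; [lra|].
  apply Rle_trans with (T / tau * tau); [|apply Rmult_le_compat_r; lra].
  unfold Rdiv; rewrite Rmult_assoc, Rinv_l; lra.
Qed.

(* Truncated subtraction makes the slope 1 before [n] and [mu ^ (i - n)] from [n] on. *)
Definition barrier (eps mu : R) (n i : nat) : R :=
  eps + INR (n - i) + mu ^ (i - n) / (1 - mu).

Lemma barrier_step (eps mu : R) (n i : nat) :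
  mu < 1 -> barrier eps mu n i - barrier eps mu n (S i) = mu ^ (i - n).
Proof.
  intros Hmu; unfold barrier.
  destruct (Nat.le_gt_cases n i) as [H|H].
  - replace (n - i)%nat with 0%nat by lia; replace (n - S i)%nat with 0%nat by lia.
    replace (S i - n)%nat with (S (i - n)) by lia; simpl; field; lra.
  - replace (n - i)%nat with (S (n - S i)) by lia; rewrite S_INR.
    replace (i - n)%nat with 0%nat by lia; replace (S i - n)%nat with 0%nat by lia.
    simpl; lra.
Qed.

Lemma barrier_ge (eps mu : R) (n i : nat) : 0 <= mu < 1 -> eps <= barrier eps mu n i.
Proof.
  intros Hmu; unfold barrier.
  assert (H1 := pos_INR (n - i)).
  assert (0 <= mu ^ (i - n) / (1 - mu)); [|lra].
  apply Rmult_le_pos; [apply pow_le; lra | left; apply Rinv_0_lt_compat; lra].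
Qed.

(** Each barrier slope is at least [mu] times the preceding one and at most 1, hence at most its
    average with 1 of weights [1 - p] and [p]. The margin [(mu - lam) * mu ^ m] is the same for all
    [i < m]. *)
Lemma barrier_super (mu : R) (n i m : nat) :
  lam < mu < 1 -> (i < m)%nat ->
  lam * mu ^ (i - n) + (mu - lam) * mu ^ m <= (1 - p) * mu ^ (S i - n) + p.
Proof.
  intros Hmu Him.
  assert (Hpow1 : forall k, 0 < mu ^ k <= 1).
  { intros k; split; [apply pow_lt; lra|].
    rewrite <- (pow1 k); apply pow_incr; lra. }
  assert (H1 : mu * mu ^ (i - n) <= mu ^ (S i - n)).
  { destruct (Nat.le_gt_cases n i) as [H|H].
    - replace (S i - n)%nat with (S (i - n)) by lia; simpl; lra.
    - replace (i - n)%nat with 0%nat by lia; replace (S i - n)%nat with 0%nat by lia.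
      simpl; lra. }
  assert (H2 : mu ^ m <= mu ^ (i - n)).
  { replace m with (i - n + (m - (i - n)))%nat by lia; rewrite pow_add.
    generalize (Hpow1 (i - n)%nat) (Hpow1 (m - (i - n))%nat); nra. }
  generalize (Hpow1 (S i - n)%nat); nra.
Qed.

(* Maximum principle: [v i - barrier i] cannot reach a positive supremum, because
   the barrier is a strict supersolution and only finitely many coordinates exceed
   [eps] on a bounded time interval. *)
Lemma below_barrier (eps mu : R) (n : nat) :
  0 < eps -> lam < mu < 1 -> (1 <= n)%nat -> v n 0 <= eps ->
  forall i t, 0 <= t -> v i t <= barrier eps mu n i.
Proof.
  intros He Hmu Hn Hvn.
  assert (Hinit : forall i, v i 0 <= barrier eps mu n i).
  { assert (P0 := Hprof 0 ltac:(lra)).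
    intros i; destruct (Nat.le_gt_cases n i) as [H|H].
    - apply Rle_trans with eps; [|apply barrier_ge; lra].
      apply Rle_trans with (2 := Hvn); exact (profile_decr _ n i P0 H).
    (* Going down from [n], the slopes of [v] are at most 1, the slope of the barrier. *)
    - assert (Hk : forall k, (k <= n)%nat -> v (n - k)%nat 0 <= eps + INR k).
      { destruct P0 as (_ & _ & Hstep & _).
        induction k as [|k IH]; intros Hk; [rewrite Nat.sub_0_r; simpl; lra|].
        rewrite S_INR; specialize (IH ltac:(lia)); specialize (Hstep (n - S k)%nat).
        simpl in Hstep; replace (S (n - S k)) with (n - k)%nat in Hstep by lia; lra. }
      specialize (Hk (n - i)%nat ltac:(lia)).
      replace (n - (n - i))%nat with i in Hk by lia.
      unfold barrier; assert (0 <= mu ^ (i - n) / (1 - mu)); [|lra].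
      apply Rmult_le_pos; [apply pow_le; lra | left; apply Rinv_0_lt_compat; lra]. }
  intros i0 T HT.
  destruct (tail_small_bounded_time eps T He) as [m Hm].
  set (D := fun i t => v i t - barrier eps mu n i).
  assert (Htail : forall i t, (m <= i)%nat -> 0 <= t <= T -> D i t <= 0).
  { intros i t Hi Ht; unfold D.
    assert (H1 := profile_decr _ m i (Hprof t ltac:(lra)) Hi); simpl in H1.
    assert (H2 := barrier_ge eps mu n i ltac:(lra)).
    specialize (Hm t Ht); lra. }
  (* Index 0 carries no differential equation; both slopes there equal 1, so a near-maximum at index
     0 is one at index 1. *)
  assert (H01 : forall t, 0 <= t -> D 0%nat t = D 1%nat t).
  { intros t Ht; unfold D; destruct (Hprof t Ht) as (H & _).
    assert (H2 := barrier_step eps mu n 0 ltac:(lra)).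
    replace (0 - n)%nat with 0%nat in H2 by lia; simpl in H2; lra. }
  enough (HD : D i0 T <= 0) by (unfold D in HD; lra).
  apply Rnot_lt_le; intros Hpos.
  set (E := fun x => exists i t, 0 <= t <= T /\ x = D i t).
  destruct (completeness E) as [eta [Hub Hlub]].
  { exists (v 0%nat 0 + L * T); intros x (i & t & Ht & ->); unfold D.
    assert (H1 := profile_decr _ 0 i (Hprof t ltac:(lra)) ltac:(lia)); simpl in H1.
    assert (H2 := lip_increment 0 0 t ltac:(lra)).
    assert (H3 := barrier_ge eps mu n i ltac:(lra)).
    assert (L * (t - 0) <= L * T) by (apply Rmult_le_compat_l; lra). lra. }
  { exists (D i0 T), i0, T; split; [lra | reflexivity]. }
  assert (Hub' : forall i t, 0 <= t <= T -> D i t <= eta).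
  { intros i t Ht; apply Hub; exists i, t; split; [exact Ht | reflexivity]. }
  assert (Heta : 0 < eta) by (generalize (Hub' i0 T ltac:(lra)); lra).
  set (delta := (mu - lam) * mu ^ m).
  assert (Hdelta : 0 < delta)
    by (apply Rmult_lt_0_compat; [lra | apply pow_lt; lra]).
  (* [rho <= eta] keeps [v (S i)] above the barrier, hence positive, so [g] equals [p];
     [rho <= delta / 4] limits the two neighbour errors to [delta / 2] in total. *)
  set (rho := Rmin eta (delta / 4)).
  assert (Hr1 : rho <= eta) by apply Rmin_l.
  assert (Hr2 : rho <= delta / 4) by apply Rmin_r.
  assert (Hrho : 0 < rho) by (apply Rmin_glb_lt; lra).
  destruct (higher_earlier L rho (delta / 2) HL Hrho ltac:(lra))
    as (tau & kappa & Htau & Hk & Hk2 & HLt & Hpush).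
  assert (Hex : exists i t, 0 <= t <= T /\ eta - kappa < D (S i) t).
  { apply NNPP; intros Hno.
    assert (eta <= eta - kappa); [|lra].
    apply Hlub; intros x (i & t & Ht & ->); apply Rnot_lt_le; intros Hlt.
    apply Hno; destruct i as [|i].
    - exists 0%nat, t; split; [exact Ht|]; rewrite <- H01 by lra; exact Hlt.
    - exists i, t; split; assumption. }
  destruct Hex as (i & t & Ht & HDt).
  assert (Him : (S i < m)%nat).
  { apply Nat.nle_gt; intros Hmi; generalize (Htail (S i) t Hmi Ht); lra. }
  (* Starting from a nonpositive value, [D] rises by at most [rho / 2] in time [tau], while
     [eta - kappa >= rho / 2]. *)
  assert (Htt : tau < t).
  { apply Rnot_le_lt; intros Hle.
    assert (H1 := lip_increment (S i) 0 t ltac:(lra)).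
    assert (L * (t - 0) <= L * tau) by (apply Rmult_le_compat_l; lra).
    specialize (Hinit (S i)); unfold D in HDt; lra. }
  assert (HDlip : lipschitz_nonneg L (D (S i))).
  { intros x y Hx Hy; unfold D.
    replace (v (S i) x - barrier eps mu n (S i) - (v (S i) y - barrier eps mu n (S i)))
      with (v (S i) x - v (S i) y) by ring.
    apply Hlip; assumption. }
  assert (H := Hpush (D (S i)) N eta t HN HDlip Htt).
  assert (Hfin : eta + kappa < D (S i) (t - tau));
    [|generalize (Hub' (S i) (t - tau) ltac:(lra)); lra].
  apply H; [|exact HDt].
  intros s Hs HNs HDs.
  exists (drift lam p (fun j => v j s) (S i)); split.
  { unfold D; evar_last.
    - apply (is_derive_minus (V := R_NormedModule)).
      + apply Hder; [lra | exact HNs | lia].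
      + apply is_derive_const.
    - unfold minus, plus, opp, zero; simpl; ring. }
  assert (Hv : 0 < v (S i) s).
  { assert (H1 := barrier_ge eps mu n (S i) ltac:(lra)); unfold D in HDs; lra. }
  unfold drift; rewrite g_pos by exact Hv; simpl pred.
  assert (B1 := barrier_step eps mu n i ltac:(lra)).
  assert (B2 := barrier_step eps mu n (S i) ltac:(lra)).
  assert (B3 := barrier_super mu n i m Hmu ltac:(lia)); fold delta in B3.
  assert (U1 := Hub' i s ltac:(lra)); assert (U2 := Hub' (S (S i)) s ltac:(lra)).
  unfold D in U1, U2, HDs.
  assert (H1 : lam * (v i s - v (S i) s - mu ^ (i - n)) <= rho) by nra.
  assert (H2 : (1 - p) * (v (S (S i)) s - v (S i) s + mu ^ (S i - n)) <= rho) by nra.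
  lra.
Qed.

(** The solution stays below a barrier of base [eps / 2] at all times, and that barrier falls to
    [eps] at a large index. *)
Lemma uniform_tail (eps : R) :
  0 < eps -> exists m, forall t, 0 <= t -> v m t <= eps.
Proof.
  intros He.
  set (mu := (1 + lam) / 2).
  assert (Hmu : lam < mu < 1) by (unfold mu; lra).
  destruct (Hprof 0 ltac:(lra)) as (_ & _ & _ & H0).
  destruct (H0 (eps / 2) ltac:(lra)) as [n Hn].
  assert (Hn' : v (S n) 0 <= eps / 2).
  { apply Rle_trans with (2 := Hn).
    exact (profile_decr _ n (S n) (Hprof 0 ltac:(lra)) ltac:(lia)). }
  destruct (pow_lt_1_eventually mu (eps / 2 * (1 - mu))) as [k Hk];
    [lra | apply Rmult_lt_0_compat; lra |].
  exists (S n + k)%nat; intros t Ht.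
  apply Rle_trans with (1 := below_barrier (eps / 2) mu (S n) ltac:(lra) Hmu
                              ltac:(lia) Hn' (S n + k) t Ht).
  unfold barrier.
  replace (S n - (S n + k))%nat with 0%nat by lia.
  replace (S n + k - S n)%nat with k by lia; simpl INR.
  assert (mu ^ k / (1 - mu) <= eps / 2); [|lra].
  apply Rmult_le_reg_r with (1 - mu); [lra|].
  unfold Rdiv at 1; rewrite Rmult_assoc, Rinv_l by lra; lra.
Qed.

(** Some coordinate stays below 1, and slopes at most 1 carry this bound back to index 0. *)
Lemma uniform_bound : exists B, forall i t, 0 <= t -> 0 <= v i t <= B.
Proof.
  destruct (uniform_tail 1 ltac:(lra)) as [m Hm].
  exists (1 + INR m); intros i t Ht.
  assert (Pt := Hprof t Ht); specialize (Hm t Ht).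
  split; [apply Pt|].
  apply Rle_trans with (v 0%nat t); [exact (profile_decr _ 0 i Pt ltac:(lia))|].
  destruct Pt as (_ & _ & Hstep & _).
  assert (Hk : forall k, v 0%nat t <= v k t + INR k).
  { induction k as [|k IH]; [simpl; lra|].
    rewrite S_INR; specialize (Hstep k); simpl in *; lra. }
  specialize (Hk m); lra.
Qed.

(** * Stationary inequalities for the coordinatewise limits superior and inferior *)

Definition upper (i : nat) : R := limsup_infty (v i).
(** The liminf, written as a limsup of [- v i] so that the same lemmas serve both. *)
Definition lower (i : nat) : R := - limsup_infty (fun t => - v i t).

Lemma upper_correct (i : nat) : is_limsup (v i) (upper i).
Proof.
  destruct uniform_bound as [B HB].
  exact (limsup_infty_correct (v i) 0 B (HB i)).
Qed.

Lemma lower_correct (i : nat) : is_limsup (fun t => - v i t) (- lower i).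
Proof.
  destruct uniform_bound as [B HB].
  unfold lower; rewrite Ropp_involutive.
  apply (limsup_infty_correct _ (- B) 0); intros t Ht; specialize (HB i t Ht); lra.
Qed.

(** Inequalities between coordinates up to a constant pass to the limsup; vanishing at infinity
    comes from the uniform tail bound. *)
Lemma upper_profile : profile upper.
Proof.
  assert (Hle : forall i j c, (forall t, 0 <= t -> v i t <= v j t + c) ->
            upper i <= upper j + c)
    by (intros i j c; apply is_limsup_le; apply upper_correct).
  split; [|split; [|split]].
  - assert (upper 0 <= upper 1 + 1).
    { apply Hle; intros t Ht; destruct (Hprof t Ht) as (H & _); lra. }
    assert (upper 1 <= upper 0 + -1); [|lra].
    apply Hle; intros t Ht; destruct (Hprof t Ht) as (H0 & _); lra.
  - intros i; rewrite <- (Rplus_0_r (upper i)).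
    apply (is_limsup_le (fun _ => 0) (v i)); [apply is_limsup_const | apply upper_correct |].
    intros t Ht; destruct (Hprof t Ht) as (_ & H & _); specialize (H i); lra.
  - intros i.
    assert (upper i <= upper (S i) + 1).
    { apply Hle; intros t Ht; destruct (Hprof t Ht) as (_ & _ & H & _).
      specialize (H i); simpl in H; lra. }
    assert (upper (S i) <= upper i + 0); [|lra].
    apply Hle; intros t Ht; destruct (Hprof t Ht) as (_ & _ & H0 & _).
    specialize (H0 i); simpl in H0; lra.
  - intros eps He; destruct (uniform_tail eps He) as [m Hm]; exists m.
    rewrite <- (Rplus_0_r eps).
    apply (is_limsup_le (v m) (fun _ => eps)); [apply upper_correct | apply is_limsup_const |].
    intros t Ht; specialize (Hm t Ht); lra.
Qed.

Lemma lower_step0 : lower 0 - lower 1 = 1.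
Proof.
  assert (- lower 0 <= - lower 1 + -1).
  { apply (is_limsup_le _ _ _ _ _ (lower_correct 0) (lower_correct 1)).
    intros t Ht; destruct (Hprof t Ht) as (Hs & _); lra. }
  assert (- lower 1 <= - lower 0 + 1); [|lra].
  apply (is_limsup_le _ _ _ _ _ (lower_correct 1) (lower_correct 0)).
  intros t Ht; destruct (Hprof t Ht) as (Hs & _); lra.
Qed.

Lemma lower_nonneg (i : nat) : 0 <= lower i.
Proof.
  assert (- lower i <= 0 + 0); [|lra].
  apply (is_limsup_le _ _ _ _ _ (lower_correct i) (is_limsup_const 0)).
  intros t Ht; destruct (Hprof t Ht) as (_ & H & _); specialize (H i); simpl in H; lra.
Qed.

(** If the inequality failed by [q], the drift of [v (S i)] near its limsup would eventually be at
    most [- q / 2], since the neighbours hardly exceed their own limsups. *)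
Lemma upper_sub_stationary : sub_stationary lam p upper.
Proof.
  intros i Hpos; apply Rnot_lt_le; intros Hlt.
  set (q := (1 - p) * (upper (S i) - upper (S (S i))) + p - lam * (upper i - upper (S i))).
  assert (Hq : 0 < q) by (unfold q; lra).
  destruct (proj1 (upper_correct i) (q / 8) ltac:(lra)) as [T1 HT1].
  destruct (proj1 (upper_correct (S (S i))) (q / 8) ltac:(lra)) as [T2 HT2].
  (* The first bound makes [v (S i)] positive, so [g] equals [p]; the second keeps each of the two
     difference terms within [q / 4]. *)
  set (rho := Rmin (upper (S i)) (q / 8)).
  assert (Hr1 : rho <= upper (S i)) by apply Rmin_l.
  assert (Hr2 : rho <= q / 8) by apply Rmin_r.
  apply (fluctuation L (v (S i)) N (upper (S i)) rho (q / 2) (Rmax T1 T2) HL HN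
           (Hlip (S i)) (upper_correct (S i))); [apply Rmin_glb_lt; lra | lra |].
  intros s Hs Hs0 HNs Hvs.
  exists (drift lam p (fun j => v j s) (S i)); split; [apply Hder; [lra | exact HNs | lia]|].
  specialize (HT1 s (Rle_trans _ _ _ (Rmax_l T1 T2) Hs)).
  specialize (HT2 s (Rle_trans _ _ _ (Rmax_r T1 T2) Hs)).
  unfold drift; rewrite g_pos by lra; simpl pred.
  assert (H1 : lam * (v i s - v (S i) s - (upper i - upper (S i))) <= q / 4) by nra.
  assert (H2 : (1 - p) * (v (S (S i)) s - v (S i) s + (upper (S i) - upper (S (S i))))
                 <= q / 4) by nra.
  unfold q in *; lra.
Qed.

(** The mirror argument for [- v (S i)], with [g] entering through its bound [p]. *)
Lemma lower_super_stationary : super_stationary lam p lower.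
Proof.
  intros i; apply Rnot_lt_le; intros Hlt.
  set (q := lam * (lower i - lower (S i)) - ((1 - p) * (lower (S i) - lower (S (S i))) + p)).
  assert (Hq : 0 < q) by (unfold q; lra).
  destruct (proj1 (lower_correct i) (q / 8) ltac:(lra)) as [T1 HT1].
  destruct (proj1 (lower_correct (S (S i))) (q / 8) ltac:(lra)) as [T2 HT2].
  assert (Hl : lipschitz_nonneg L (fun t => - v (S i) t)).
  { intros x y Hx Hy.
    replace (- v (S i) x - - v (S i) y) with (- (v (S i) x - v (S i) y)) by ring.
    rewrite Rabs_Ropp; apply Hlip; assumption. }
  apply (fluctuation L _ N _ (q / 8) (q / 2) (Rmax T1 T2) HL HN
           Hl (lower_correct (S i))); [lra | lra |].
  intros s Hs Hs0 HNs Hvs.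
  exists (- drift lam p (fun j => v j s) (S i)); split.
  { apply (is_derive_opp (v (S i))), Hder; [lra | exact HNs | lia]. }
  specialize (HT1 s (Rle_trans _ _ _ (Rmax_l T1 T2) Hs)).
  specialize (HT2 s (Rle_trans _ _ _ (Rmax_r T1 T2) Hs)).
  assert (Hg := g_le lam p (fun j => v j s) (S i) (proj1 Hp)).
  unfold drift; simpl pred.
  assert (H1 : lam * (lower i - lower (S i) - (v i s - v (S i) s)) <= q / 4) by nra.
  assert (H2 : (1 - p) * (lower (S (S i)) - lower (S i) + (v (S i) s - v (S (S i)) s))
                 <= q / 4) by nra.
  unfold q in *; lra.
Qed.

(** * Convergence to the stationary point *)

Variable vI : nat -> R.
Hypothesis HvI : is_vI lam p vI.

Lemma vI_sub_stationary : sub_stationary lam p vI.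
Proof.
  intros i Hi; assert (H := proj2 HvI (S i) ltac:(lia)).
  unfold drift in H; rewrite g_pos in H by exact Hi; simpl pred in H; lra.
Qed.

Lemma vI_super_stationary : super_stationary lam p vI.
Proof.
  intros i; assert (H := proj2 HvI (S i) ltac:(lia)).
  assert (Hg := g_le lam p vI (S i) (proj1 Hp)).
  unfold drift in H; simpl pred in H; lra.
Qed.

(** [vI] satisfies both stationary inequalities, so comparison gives [upper <= vI <= lower], while
    eventually [v i t] lies between [lower i - eps] and [upper i + eps]. *)
Lemma coordinate_convergence (i : nat) (eps : R) :
  0 < eps -> exists T, forall t, T <= t -> Rabs (v i t - vI i) <= eps.
Proof.
  intros He.
  assert (PI := in_Vbar_profile vI (proj1 HvI)).
  assert (H1 : upper i <= vI i).
  { apply (stationary_comparison lam p); try assumption; try apply PI.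
    - apply upper_profile.
    - apply upper_sub_stationary.
    - apply vI_super_stationary. }
  assert (H2 : vI i <= lower i).
  { apply (stationary_comparison lam p); try assumption.
    - apply lower_step0.
    - apply lower_nonneg.
    - apply vI_sub_stationary.
    - apply lower_super_stationary. }
  destruct (proj1 (upper_correct i) eps He) as [T1 HT1].
  destruct (proj1 (lower_correct i) eps He) as [T2 HT2].
  exists (Rmax T1 T2); intros t Ht.
  specialize (HT1 t (Rle_trans _ _ _ (Rmax_l T1 T2) Ht)).
  specialize (HT2 t (Rle_trans _ _ _ (Rmax_r T1 T2) Ht)).
  apply Rabs_le; lra.
Qed.

(** Finitely many coordinates are treated one by one; beyond them both sequences lie between 0 and
    [eps]. *)
Lemma uniform_convergence (eps : R) :
  0 < eps -> exists T, forall t, T <= t -> forall i, Rabs (v i t - vI i) <= eps.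
Proof.
  intros He.
  assert (PI := in_Vbar_profile vI (proj1 HvI)).
  destruct (uniform_tail eps He) as [m1 Hm1].
  destruct (proj2 (proj2 (proj2 PI)) eps He) as [m2 Hm2].
  assert (Hfin : forall m, exists T, forall t, T <= t ->
            forall i, (i < m)%nat -> Rabs (v i t - vI i) <= eps).
  { induction m as [|m [T HT]]; [exists 0; intros; lia|].
    destruct (coordinate_convergence m eps He) as [T' HT'].
    exists (Rmax T T'); intros t Ht i Hi.
    destruct (Nat.eq_dec i m) as [->|Hne].
    - apply HT', Rle_trans with (2 := Ht), Rmax_r.
    - apply HT; [apply Rle_trans with (2 := Ht), Rmax_l | lia]. }
  destruct (Hfin (max m1 m2)) as [T HT].
  exists (Rmax T 0); intros t Ht i.
  assert (HtT : T <= t) by (apply Rle_trans with (2 := Ht), Rmax_l).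
  assert (Ht0 : 0 <= t) by (apply Rle_trans with (2 := Ht), Rmax_r).
  destruct (Nat.lt_ge_cases i (max m1 m2)) as [Hi|Hi]; [apply HT; assumption|].
  assert (Pt := Hprof t Ht0).
  assert (H1 := profile_decr _ m1 i Pt ltac:(lia)); simpl in H1.
  assert (H2 := profile_decr _ m2 i PI ltac:(lia)).
  specialize (Hm1 t Ht0).
  assert (H3 := proj1 (proj2 Pt) i); simpl in H3.
  assert (H4 := proj1 (proj2 PI) i).
  apply Rabs_le; lra.
Qed.

End Fluid.

(** * From uniform convergence to the weighted norm *)

(** The weights sum to 2, so the norm is at most [sqrt 2 * e]. *)
Lemma norm_w_le (x : nat -> R) (e : R) :
  0 <= e -> (forall i, Rabs (x i) <= e) -> norm_w x <= 2 * e.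
Proof.
  intros He Hx; unfold norm_w.
  assert (Hhalf : Rabs (/ 2) < 1) by (rewrite Rabs_right; lra).
  assert (Hpow : forall i, 0 < (/ 2) ^ i) by (intros; apply pow_lt; lra).
  rewrite <- (sqrt_Rsqr (2 * e)) by lra; apply sqrt_le_1_alt.
  apply Rle_trans with (Series (fun i => (/ 2) ^ i * e ^ 2)).
  - apply Series_le.
    + intros i; split; [apply Rmult_le_pos; [left; apply Hpow | apply pow2_ge_0]|].
      apply Rmult_le_compat_l; [left; apply Hpow|].
      rewrite <- (pow2_abs (x i)); apply pow_incr; split; [apply Rabs_pos | apply Hx].
    + apply ex_series_scal_r, ex_series_geom, Hhalf.
  - rewrite Series_scal_r, Series_geom by exact Hhalf; unfold Rsqr; nra.
Qed.

Theorem theorem3 (lam p : R) (Hlam : 0 <= lam < 1) (Hp : 0 <= p <= 1)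
  (v0 : nat -> R) (Hv0 : in_Vbar v0)
  (v : nat -> R -> R) (Hv : fluid_solution lam p v0 v)
  (vI : nat -> R) (HvI : is_vI lam p vI) :
  is_lim (fun t => norm_w (fun i => v i t - vI i)) p_infty 0.
Proof.
  destruct Hv as ([L HL] & HV & _ & _ & (N & HN & Hder)).
  assert (HL0 : 0 <= L).
  { assert (H := HL 0%nat 1 0 ltac:(lra) ltac:(lra)).
    generalize (Rabs_pos (v 0%nat 1 - v 0%nat 0)).
    rewrite (Rabs_right (1 - 0)) in H by lra; lra. }
  apply is_lim_spec; intros eps; simpl.
  assert (He := cond_pos eps).
  (* A uniform error [eps / 4] gives norm at most [eps / 2], strictly below [eps]. *)
  destruct (uniform_convergence lam p L v N Hlam Hp HL0 HL
              (fun t Ht => in_Vbar_profile _ (HV t Ht)) HN Hder vI HvI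
              (eps / 4) ltac:(lra)) as [T HT].
  exists T; intros t Ht.
  assert (H := norm_w_le (fun i => v i t - vI i) (eps / 4) ltac:(lra)
                 (HT t ltac:(lra))).
  rewrite Rminus_0_r, Rabs_right; [lra | apply Rle_ge, sqrt_pos].
Qed.
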